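(* Let $m\ge2$, let $K$ be a field of characteristic $p>0$ containing a primitive $m$th root of unity, with $p\nmid m$ and $p\ne2$. Let $G=G(m,m,2)$ (the dihedral group of order $2m$), take $\hbar=0$ and generic parameters, let $A=K[x,y]$, and let $\tau=\rho_0$ be the trivial representation. Then the maximal proper graded submodule $J$ of the Verma module $M(\tau)=A$ of the rational Cherednik algebra $\mathbf{H}(G)$ is the ideal generated by $xy$ and $x^m+y^m$, and the Hilbert series of $A/J$ is $(1+t)(1+t+\cdots+t^{m-1})$.
   Context: $G(m,m,2)$ is the group of $2\times2$ monomial matrices over $K$ whose nonzero entries are $m$th roots of unity with product $1$; it acts on $\mathfrak{h}=K^2$ and on $\mathfrak{h}^*$ with coordinate basis $x=x_1$, $y=x_2$. Its reflections (finite-order elements $s$ with $\operatorname{rank}(1-s)=1$) are, for $0\le\ell<m$, $x\mapsto\xi^\ell y$, $y\mapsto\xi^{-\ell}x$, with $\xi$ a primitive $m$th root of unity. For a reflection $s$ choose $\alpha_s\in\mathfrak{h}^*$ spanning the image of $1-s$ and $\alpha_s^\vee\in\mathfrak{h}$ with $(1-s)f=(\alpha_s^\vee,f)\alpha_s$ for $f\in\mathfrak{h}^*$; let $c_s\in K$ depend only on the conjugacy class of $s$ (for $m$ even there are two classes of reflections, according to the parity of $\ell$, with parameters $d$ for $\ell$ even and $c$ for $\ell$ odd; for $m$ odd there is one class). Generic means these parameters are algebraically independent over the prime field. $\mathbf{H}(G)$ ($\hbar=0$) is the quotient of $K[G]\ltimes T(\mathfrak{h}\oplus\mathfrak{h}^*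 )$ by $[f,f']=0$, $[v,v']=0$, $[v,f]=-\sum_sc_s(v,\alpha_s)(f,\alpha_s^\vee)s$ for $f,f'\in\mathfrak{h}^*$, $v,v'\in\mathfrak{h}$, graded with $\mathfrak{h}^*$ in degree $1$, $\mathfrak{h}$ in degree $-1$, $G$ in degree $0$. The Verma module of $\tau$ is $M(\tau)=A\otimes_K\tau$ with $A=\mathrm{Sym}(\mathfrak{h}^* )$ acting by multiplication, $G$ diagonally, and $v\in\mathfrak{h}$ by the Dunkl operator $D_v(f\otimes w)=-\sum_sc_s\frac{(v,\alpha_s)}{\alpha_s}(1-s)f\otimes sw$. For irreducible $\tau$ it has a unique maximal proper graded submodule $J$; $\tau$ is placed in degree $0$. *)

(* Defs.v *)
From HB Require Import structures.
From mathcomp Require Import all_boot all_order all_algebra.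
From mathcomp Require Import mpoly.

Set Implicit Arguments.
Unset Strict Implicit.
Unset Printing Implicit Defensive.

Import GRing.Theory.
Local Open Scope ring_scope.

Section Groups.
Variables (K : fieldType) (n : nat).

Definition monomial_mx (g : 'M[K]_n) : bool :=
  [forall i, #|[set j | g i j != 0]| == 1%N]
  && [forall j, #|[set i | g i j != 0]| == 1%N].

Definition Gmm (m : nat) : {pred 'M[K]_n} := fun g =>
  [&& monomial_mx g,
      [forall i, forall j, (g i j != 0) ==> (g i j ^+ m == 1)]
    & \prod_i \prod_(j | g i j != 0) g i j == 1].

(* Elements of [Gmm m] all have finite order, so the finite-order clause in the
   definition of a reflection is omitted. *)
Definition reflection (m : nat) (s : 'M[K]_n) : bool :=
  (s \in Gmm m) && (\rank (1%:M - s) == 1%N).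

(* Vectors of h are columns, on which g acts by [g *m v]; elements of h^* are
   rows (coordinates in x_1, ..., x_n), with the contragredient action. *)
Definition dual_act (g : 'M[K]_n) (f : 'rV[K]_n) : 'rV[K]_n := f *m invmx g.

Definition pairing (v : 'cV[K]_n) (f : 'rV[K]_n) : K := (f *m v) 0 0.

(* The inclusion of h^* in A = Sym(h^* ), and the induced action of g on A. *)
Definition linform (f : 'rV[K]_n) : {mpoly K[n]} := \sum_i f 0 i *: 'X_i.

Definition poly_act (g : 'M[K]_n) (p : {mpoly K[n]}) : {mpoly K[n]} :=
  p \mPo [tuple linform (dual_act g (delta_mx 0 i)) | i < n].

Definition conj_invariant (m : nat) (c : 'M[K]_n -> K) : Prop :=
  forall g s, g \in Gmm m -> reflection m s -> c (g *m s *m invmx g) = c s.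

End Groups.

Section Reflections.
Variables (K : fieldType) (xi : K).

(* On h^* : x |-> xi^l y and y |-> xi^-l x. *)
Definition refl (l : nat) : 'M[K]_2 :=
  xi ^+ l *: delta_mx 0 1 + xi ^- l *: delta_mx 1 0.

(* alpha_s and alpha_s^vee for s = refl l, see [reflE] below. Everything that
   follows is independent of this choice, since rescaling alpha_s rescales
   alpha_s^vee inversely. *)
Definition root_form (l : nat) : 'rV[K]_2 := delta_mx 0 0 - xi ^+ l *: delta_mx 0 1.
Definition coroot (l : nat) : 'cV[K]_2 := delta_mx 0 0 - xi ^- l *: delta_mx 1 0.

End Reflections.

Section GroupFacts.
Variables (K : fieldType) (m : nat).

Lemma eq_mx2 (A B : 'M[K]_2) :
  A 0 0 = B 0 0 -> A 0 1 = B 0 1 -> A 1 0 = B 1 0 -> A 1 1 = B 1 1 -> A = B.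
Proof.
move=> h1 h2 h3 h4; apply/matrixP => i j.
have P (k : 'I_2) : k = 0 \/ k = 1.
  by case: k => [[|[|k]] hk] //; [left|right]; apply: val_inj.
by case: (P i) => ->; case: (P j) => ->.
Qed.

Lemma big_I2 (T : Type) (idx : T) (op : Monoid.law idx) (F : 'I_2 -> T) :
  \big[op/idx]_(i < 2) F i = op (F 0) (F 1).
Proof.
rewrite big_ord_recl big_ord_recl big_ord0 Monoid.mulm1.
by congr (op (F _) (F _)); apply: val_inj.
Qed.

Lemma card_set2 (P : pred 'I_2) : #|[set j | P j]| = (P 0%R + P 1%R)%N.
Proof.
rewrite cardsE -sum1_card big_mkcond /= big_I2 !unfold_in.
by case: (P 0); case: (P 1).
Qed.

Definition rot_mx (a : K) : 'M[K]_2 := a *: delta_mx 0 0 + a^-1 *: delta_mx 1 1.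
Definition swp_mx (a : K) : 'M[K]_2 := a *: delta_mx 0 1 + a^-1 *: delta_mx 1 0.

Lemma forall2 (P : pred 'I_2) : [forall i, P i] = P 0 && P 1.
Proof.
apply/forallP/andP => [h|[h0 h1] i]; first by rewrite !h.
suff [->|->] : i = 0 \/ i = 1 by [].
by case: i => [[|[|k]] hk] //; [left|right]; apply: val_inj.
Qed.

Lemma GmmP (g : 'M[K]_2) : (0 < m)%N ->
  reflect (exists2 a, a ^+ m = 1 & g = rot_mx a \/ g = swp_mx a) (g \in Gmm m).
Proof.
move=> m0.
have -> : (g \in Gmm m) =
    [&& [&& #|[set j | g 0 j != 0]| == 1%N, #|[set j | g 1 j != 0]| == 1%N,
            #|[set i | g i 0 != 0]| == 1%N & #|[set i | g i 1 != 0]| == 1%N],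
        [&& (g 0 0 != 0) ==> (g 0 0 ^+ m == 1), (g 0 1 != 0) ==> (g 0 1 ^+ m == 1),
            (g 1 0 != 0) ==> (g 1 0 ^+ m == 1) & (g 1 1 != 0) ==> (g 1 1 ^+ m == 1)]
      & \prod_i \prod_(j | g i j != 0) g i j == 1].
  rewrite unfold_in /Gmm /monomial_mx; congr [&& _, _ & _].
    rewrite (forall2 (fun i => #|[set j | g i j != 0]| == 1%N)).
    by rewrite (forall2 (fun j => #|[set i | g i j != 0]| == 1%N)) -andbA.
  rewrite (forall2 (fun i => [forall j, (g i j != 0) ==> (g i j ^+ m == 1)])).
  rewrite (forall2 (fun j => (g 0 j != 0) ==> (g 0 j ^+ m == 1))).
  by rewrite (forall2 (fun j => (g 1 j != 0) ==> (g 1 j ^+ m == 1))) -andbA.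
rewrite !card_set2.
rewrite big_I2 (big_mkcond (fun j => g 0 j != 0)) (big_mkcond (fun j => g 1 j != 0)) /= !big_I2.
apply: (iffP idP).
- case: (eqVneq (g 0 0) 0) => h00; case: (eqVneq (g 0 1) 0) => h01;
  case: (eqVneq (g 1 0) 0) => h10; case: (eqVneq (g 1 1) 0) => h11 //=;
  rewrite ?mulr1 ?mul1r ?andbT //.
  + case/andP=> /andP[/eqP h1 /eqP h2] /eqP h3.
    exists (g 0 1) => //; right; apply: eq_mx2;
    rewrite !mxE /= ?(mulr0, mulr1, addr0, add0r) //.
    by apply: (mulfI h01); rewrite h3 divff.
  + case/andP=> /andP[/eqP h1 /eqP h2] /eqP h3.
    exists (g 0 0) => //; left; apply: eq_mx2;
    rewrite !mxE /= ?(mulr0, mulr1, addr0, add0r) //.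
    by apply: (mulfI h00); rewrite h3 divff.
- case=> a ham [->|->]; rewrite !mxE /= ?(mulr0, mulr1, addr0, add0r) eqxx /=;
  have a0 : a != 0 by apply: contra_eq_neq ham => ->;
    rewrite expr0n eqn0Ngt m0 /= eq_sym oner_eq0.
  + by rewrite invr_eq0 a0 /= !(mul1r, mulr1) divff // exprVn ham invr1 !eqxx.
  + by rewrite invr_eq0 a0 /= !(mul1r, mulr1) divff // exprVn ham invr1 !eqxx.
Qed.

End GroupFacts.

Section LinearFacts.
Variables (K : fieldType) (n : nat).
Implicit Types (g h : 'M[K]_n) (f : 'rV[K]_n) (v : 'cV[K]_n).

Lemma pairingDl v w f : pairing (v + w) f = pairing v f + pairing w f.
Proof. by rewrite /pairing mulmxDr mxE. Qed.
Lemma pairingZl a v f : pairing (a *: v) f = a * pairing v f.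
Proof. by rewrite /pairing -scalemxAr mxE. Qed.
Lemma pairingDr v f f' : pairing v (f + f') = pairing v f + pairing v f'.
Proof. by rewrite /pairing mulmxDl mxE. Qed.
Lemma pairingZr a v f : pairing v (a *: f) = a * pairing v f.
Proof. by rewrite /pairing -scalemxAl mxE. Qed.

Lemma pairing_act g v f : g \in unitmx -> pairing (g *m v) (dual_act g f) = pairing v f.
Proof. by move=> ug; rewrite /pairing /dual_act !mulmxA mulmxKV. Qed.

Lemma dual_actD g f f' : dual_act g (f + f') = dual_act g f + dual_act g f'.
Proof. exact: mulmxDl. Qed.
Lemma dual_actZ g a f : dual_act g (a *: f) = a *: dual_act g f.
Proof. by rewrite /dual_act scalemxAl. Qed.
Lemma dual_act1 f : dual_act 1%:M f = f.
Proof. by rewrite /dual_act invmx1 mulmx1. Qed.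

Lemma invmxE g h : g *m h = 1%:M -> invmx g = h.
Proof.
move=> gh; have [ug _] := mulmx1_unit gh.
by rewrite -[RHS](mulKmx ug) gh mulmx1.
Qed.

Lemma dual_actM g h f : g \in unitmx -> h \in unitmx ->
  dual_act (g *m h) f = dual_act g (dual_act h f).
Proof.
move=> ug uh; rewrite /dual_act (@invmxE _ (invmx h *m invmx g)) ?mulmxA //.
by rewrite mulmxK // mulmxV.
Qed.

Lemma linformD f f' : linform (f + f') = linform f + linform f'.
Proof. by rewrite -big_split; apply: eq_bigr => i _; rewrite mxE scalerDl. Qed.
Lemma linformZ a f : linform (a *: f) = a *: linform f.
Proof. by rewrite scaler_sumr; apply: eq_bigr => i _; rewrite mxE scalerA. Qed.
Lemma linformB f f' : linform (f - f') = linform f - linform f'.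
Proof. by rewrite linformD -scaleN1r linformZ scaleN1r. Qed.
Lemma linform_sum (I : Type) (r : seq I) (F : I -> 'rV[K]_n) :
  linform (\sum_(i <- r) F i) = \sum_(i <- r) linform (F i).
Proof.
elim/big_rec2: _ => [|i p f _ <-]; last by rewrite linformD.
by rewrite -[X in linform X](scale0r 0) linformZ scale0r.
Qed.
Lemma linform_delta i : linform (delta_mx 0 i) = 'X_i :> {mpoly K[n]}.
Proof.
rewrite /linform (bigD1 i) //= mxE !eqxx scale1r big1 ?addr0 // => j ji.
by rewrite mxE eqxx (negPf ji) scale0r.
Qed.

Lemma poly_act_linform g f : poly_act g (linform f) = linform (dual_act g f).
Proof.
rewrite {2}(row_sum_delta f) /dual_act mulmx_suml linform_sum /poly_act.
rewrite {1}/linform raddf_sum; apply: eq_bigr => i _ /=.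
rewrite comp_mpolyZ comp_mpolyXU -tnth_nth tnth_mktuple.
by rewrite -scalemxAl linformZ.
Qed.

Lemma poly_actM g p q : poly_act g (p * q) = poly_act g p * poly_act g q.
Proof. exact: rmorphM. Qed.
Lemma poly_actD g p q : poly_act g (p + q) = poly_act g p + poly_act g q.
Proof. exact: raddfD. Qed.
Lemma poly_actB g p q : poly_act g (p - q) = poly_act g p - poly_act g q.
Proof. exact: raddfB. Qed.
Lemma poly_actN g p : poly_act g (- p) = - poly_act g p.
Proof. exact: raddfN. Qed.
Lemma poly_act_sum g (I : Type) (r : seq I) (F : I -> {mpoly K[n]}) :
  poly_act g (\sum_(i <- r) F i) = \sum_(i <- r) poly_act g (F i).
Proof. exact: raddf_sum. Qed.
Lemma poly_actZ g a p : poly_act g (a *: p) = a *: poly_act g p.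
Proof. exact: linearZ. Qed.
Lemma poly_act1 g : poly_act g 1 = 1.
Proof. exact: rmorph1. Qed.

Lemma mpoly_lin_ind (P : {mpoly K[n]} -> Prop) :
  P 1 -> (forall p q, P p -> P q -> P (p + q)) -> (forall a p, P p -> P (a *: p)) ->
  (forall f p, P p -> P (linform f * p)) -> forall p, P p.
Proof.
move=> P1 PD PZ PX.
have PM m : P 'X_[m].
  rewrite mpolyXE_id; elim/big_rec: _ => // i p _ Pp.
  elim: (m i) => [|k IH]; first by rewrite expr0 mul1r.
  by rewrite exprS -mulrA -linform_delta; apply: PX; rewrite linform_delta.
elim/mpolyind => [|a m p _ _ Pp]; first by rewrite -(scale0r 1); apply: PZ.
by apply: PD => //; apply: PZ.
Qed.

Lemma poly_act_id (p : {mpoly K[n]}) : poly_act 1%:M p = p.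
Proof.
move: p; apply: mpoly_lin_ind => [|p q hp hq|a p hp|f p hp].
- exact: poly_act1.
- by rewrite poly_actD hp hq.
- by rewrite poly_actZ hp.
- by rewrite poly_actM hp poly_act_linform dual_act1.
Qed.

Lemma poly_act_mul g h p : g \in unitmx -> h \in unitmx ->
  poly_act (g *m h) p = poly_act g (poly_act h p).
Proof.
move=> ug uh; move: p; apply: mpoly_lin_ind => [|p q hp hq|a p hp|f p hp].
- by rewrite !poly_act1.
- by rewrite !poly_actD hp hq.
- by rewrite !poly_actZ hp.
- by rewrite !poly_actM hp !poly_act_linform dual_actM.
Qed.

End LinearFacts.

Section ReflectionFacts.
Variables (K : fieldType) (m : nat) (xi : K).
Hypothesis hxi : m.-primitive_root xi.
Local Notation refl := (refl xi).
Local Notation root_form := (root_form xi).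
Local Notation coroot := (coroot xi).

Let m0 : (0 < m)%N := prim_order_gt0 hxi.

Let root_neq0 (a : K) : a ^+ m = 1 -> a != 0.
Proof. by apply: contra_eq_neq => ->; rewrite expr0n eqn0Ngt m0 /= eq_sym oner_eq0. Qed.

Let swpK (a : K) : a != 0 -> swp_mx a *m swp_mx a = 1%:M.
Proof.
by move=> a0; apply: eq_mx2; rewrite !mxE !big_I2 !mxE /=
  ?(mulr0, mul0r, mulr1, addr0, add0r) ?divff ?mulVf.
Qed.

Let rotK (a : K) : a != 0 -> rot_mx a *m rot_mx a^-1 = 1%:M.
Proof.
by move=> a0; apply: eq_mx2; rewrite !mxE !big_I2 !mxE /=
  ?(mulr0, mul0r, mulr1, addr0, add0r) ?divff ?invr_eq0.
Qed.

Lemma xiX_neq0 l : xi ^+ l != 0.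
Proof. by apply: root_neq0; rewrite exprAC (prim_expr_order hxi) expr1n. Qed.

Lemma Gmm_unit (g : 'M[K]_2) : g \in Gmm m -> g \in unitmx.
Proof.
case/(GmmP _ m0) => a /root_neq0 a0 [->|->].
  by case: (mulmx1_unit (rotK a0)).
by case: (mulmx1_unit (swpK a0)).
Qed.

Lemma GmmM (g h : 'M[K]_2) : g \in Gmm m -> h \in Gmm m -> g *m h \in Gmm m.
Proof.
case/(GmmP _ m0) => a ha [->|->]; case/(GmmP _ m0) => b hb [->|->];
  have a0 := root_neq0 ha; have b0 := root_neq0 hb; apply/(GmmP _ m0).
- exists (a * b); first by rewrite exprMn ha hb mulr1.
  by left; apply: eq_mx2; rewrite !mxE !big_I2 !mxE /=
    ?(mulr0, mul0r, mulr1, addr0, add0r) ?invfM.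
- exists (a * b); first by rewrite exprMn ha hb mulr1.
  by right; apply: eq_mx2; rewrite !mxE !big_I2 !mxE /=
    ?(mulr0, mul0r, mulr1, addr0, add0r) ?invfM.
- exists (a / b); first by rewrite exprMn exprVn ha hb invr1 mulr1.
  by right; apply: eq_mx2; rewrite !mxE !big_I2 !mxE /=
    ?(mulr0, mul0r, mulr1, addr0, add0r) ?invfM ?invrK.
- exists (a / b); first by rewrite exprMn exprVn ha hb invr1 mulr1.
  by left; apply: eq_mx2; rewrite !mxE !big_I2 !mxE /=
    ?(mulr0, mul0r, mulr1, addr0, add0r) ?invfM ?invrK.
Qed.

Lemma GmmV (g : 'M[K]_2) : g \in Gmm m -> invmx g \in Gmm m.
Proof.
case/(GmmP _ m0) => a ha [->|->]; have a0 := root_neq0 ha; apply/(GmmP _ m0).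
  rewrite (invmxE (rotK a0)); exists a^-1; last by left.
  by rewrite exprVn ha invr1.
by rewrite (invmxE (swpK a0)); exists a => //; right.
Qed.

Lemma reflK l : refl l *m refl l = 1%:M.
Proof. exact: swpK (xiX_neq0 l). Qed.

Lemma one_sub_refl l : 1%:M - refl l = coroot l *m root_form l.
Proof.
by apply: eq_mx2; rewrite !mxE big_ord1 !mxE /=
  ?(mulr0, mulr1, mul1r, addr0, add0r, subr0, sub0r) // mulrNN mulVf ?xiX_neq0.
Qed.

Lemma reflection_refl l : reflection m (refl l).
Proof.
apply/andP; split.
  apply/(GmmP _ m0); exists (xi ^+ l); last by right.
  by rewrite exprAC (prim_expr_order hxi) expr1n.
rewrite one_sub_refl eqn_leq mulmx_max_rank lt0n mxrank_eq0.
apply/eqP => /matrixP/(_ 0 0); rewrite !mxE big_ord1 !mxE /= !mulr0 !subr0 mulr1.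
by move/eqP; rewrite oner_eq0.
Qed.

(* The sums over 'I_m below are thus sums over the reflections of G(m,m,2). *)
Lemma reflectionP s : reflect (exists l : 'I_m, s = refl l) (reflection m s).
Proof.
apply: (iffP idP) => [|[l ->]]; last exact: reflection_refl.
case/andP => /(GmmP _ m0)[a ha [->|->]].
  have a0 := root_neq0 ha; have [->|a1] := eqVneq a 1.
    rewrite (_ : 1%:M - _ = 0) ?mxrank0 //.
    by apply: eq_mx2; rewrite !mxE /= ?(invr1, mulr0, mulr1, addr0, add0r) ?subrr ?oppr0.
  rewrite (_ : \rank _ = 2%N) //; apply: mxrank_unit.
  have na : 1 - a != 0 by rewrite subr_eq0 eq_sym.
  have nb : 1 - a^-1 != 0 by rewrite subr_eq0 eq_sym invr_eq1.
  suff h : (1%:M - rot_mx a) *m ((1 - a)^-1 *: delta_mx 0 0 + (1 - a^-1)^-1 *: delta_mx 1 1)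
      = 1%:M by case: (mulmx1_unit h).
  by apply: eq_mx2; rewrite !mxE !big_I2 !mxE /=
    ?(mulr0, mul0r, mulr1, addr0, add0r, subr0, sub0r) ?oppr0 ?mul0r ?addr0 ?divff.
by case: (prim_rootP hxi ha) => l -> _; exists l.
Qed.

Lemma refl_inj : injective (fun l : 'I_m => refl l).
Proof.
move=> l k /matrixP/(_ 0 1); rewrite !mxE /= !(mulr0, mulr1, addr0) => /eqP.
by rewrite (eq_prim_root_expr hxi) !modn_small // => /eqP/val_inj.
Qed.

Lemma invmx_refl l : invmx (refl l) = refl l.
Proof. exact: invmxE (reflK l). Qed.

Lemma refl_Gmm l : refl l \in Gmm m.
Proof. by case/andP: (reflection_refl l). Qed.

Lemma refl_unit l : refl l \in unitmx.
Proof. exact: Gmm_unit (refl_Gmm l). Qed.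

Lemma reflE l f : f - dual_act (refl l) f = pairing (coroot l) f *: root_form l.
Proof.
rewrite /dual_act invmx_refl -{1}[f]mulmx1 -mulmxBr one_sub_refl mulmxA.
by rewrite {1}[f *m _]mx11_scalar mul_scalar_mx.
Qed.

Lemma reflE_h l v : v - refl l *m v = pairing v (root_form l) *: coroot l.
Proof.
rewrite -{1}[v]mul1mx -mulmxBl one_sub_refl -mulmxA.
by rewrite {1}[root_form l *m _]mx11_scalar mul_mx_scalar.
Qed.

Lemma root_form_neq0 l : linform (root_form l) != 0.
Proof.
apply/eqP => /(congr1 (fun p : {mpoly K[2]} => p@_U_(0))).
rewrite mcoeff0 /linform big_I2 mcoeffD !mcoeffZ !mcoeffX !mxE /= !eqxx.
by rewrite mulr0 subr0 mulr1 [U_(1)%MM == _]eq_mnm1 /= mulr0 addr0 => /eqP; rewrite oner_eq0.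
Qed.

Lemma root_form_dvd l (p : {mpoly K[2]}) :
  exists q, q * linform (root_form l) == p - poly_act (refl l) p.
Proof.
move: p; apply: mpoly_lin_ind => [|p p' [q /eqP hq] [q' /eqP hq']|a p [q /eqP hq]|f p [q /eqP hq]].
- by exists 0; rewrite poly_act1 subrr mul0r.
- by exists (q + q'); rewrite poly_actD mulrDl hq hq' opprD addrACA.
- by exists (a *: q); rewrite poly_actZ -scalerAl hq scalerBr.
- exists (pairing (coroot l) f *: p + poly_act (refl l) (linform f) * q).
  rewrite mulrDl -mulrA hq -scalerAl [X in X + _]scalerAr.
  rewrite poly_actM mulrBr addrA; apply/eqP; congr (_ - _).
  rewrite -linformZ -reflE linformB poly_act_linform mulrBr [p * _]mulrC.
  by rewrite [p * _]mulrC subrK.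
Qed.

End ReflectionFacts.

(* H(G) is the quotient of K[G] |x T(h + h^* ) by the relations
     [f, f'] = 0,  [v, v'] = 0,
     [v, f] = - sum_s c_s (v, alpha_s) (f, alpha_s^vee) s,
   so an H(G)-module is a K-vector space with an action of G and linear maps
   from h^* and h to its endomorphisms which are G-equivariant and satisfy
   these relations. *)
Record cherednik_module (K : fieldType) (m : nat) (xi : K) (c : 'M[K]_2 -> K) :=
  CherednikModule {
    carrier :> lmodType K;
    actG : 'M[K]_2 -> carrier -> carrier;
    actX : 'rV[K]_2 -> carrier -> carrier;
    actY : 'cV[K]_2 -> carrier -> carrier;
    actG_linear : forall g, g \in Gmm m -> linear (actG g);
    actX_linear : forall f, linear (actX f);
    actY_linear : forall v, linear (actY v);
    actX_linearl : forall u, linear (actX^~ u);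
    actY_linearl : forall u, linear (actY^~ u);
    actG1 : forall u, actG 1%:M u = u;
    actGM : forall g h u, g \in Gmm m -> h \in Gmm m ->
      actG (g *m h) u = actG g (actG h u);
    actGX : forall g f u, g \in Gmm m ->
      actG g (actX f u) = actX (dual_act g f) (actG g u);
    actGY : forall g v u, g \in Gmm m ->
      actG g (actY v u) = actY (g *m v) (actG g u);
    actXC : forall f f' u, actX f (actX f' u) = actX f' (actX f u);
    actYC : forall v v' u, actY v (actY v' u) = actY v' (actY v u);
    actYX : forall v f u, actY v (actX f u) - actX f (actY v u) =
      - \sum_(l < m) (c (refl xi l) * pairing v (root_form xi l)
                       * pairing (coroot xi l) f) *: actG (refl xi l) u
  }.

Definition is_submodule (K : fieldType) (m : nat) (xi : K) (c : 'M[K]_2 -> K)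
    (M : cherednik_module m xi c) (N : M -> Prop) : Prop :=
  [/\ N 0, (forall u w, N u -> N w -> N (u + w)) & (forall a u, N u -> N (a *: u))]
  /\ [/\ (forall g u, g \in Gmm m -> N u -> N (actG g u)),
         (forall f u, N u -> N (actX f u))
       & (forall v u, N u -> N (actY v u))].

Section Verma.
Variables (K : fieldType) (m : nat) (xi : K) (c : 'M[K]_2 -> K).
Hypothesis hxi : m.-primitive_root xi.
Local Notation refl := (refl xi).
Local Notation root_form := (root_form xi).
Local Notation coroot := (coroot xi).

Fact root_form_quot (l : nat) (p : {mpoly K[2]}) :
  {q | q * linform (root_form l) = p - poly_act (refl l) p}.
Proof.
by exists (xchoose (root_form_dvd hxi l p)); apply/eqP/(xchooseP (root_form_dvd hxi l p)).
Qed.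

(* (1 - s) p / alpha_s for s = refl l; the quotient is unique since A is a domain. *)
Definition divided_diff (l : nat) (p : {mpoly K[2]}) : {mpoly K[2]} :=
  sval (root_form_quot l p).

(* The Dunkl operator on M(rho_0) = A: every s acts trivially on rho_0. *)
Definition dunkl (v : 'cV[K]_2) (p : {mpoly K[2]}) : {mpoly K[2]} :=
  - \sum_(l < m) (c (refl l) * pairing v (root_form l)) *: divided_diff l p.

Lemma divided_diffE l p :
  divided_diff l p * linform (root_form l) = p - poly_act (refl l) p.
Proof. exact: svalP (root_form_quot l p). Qed.

Lemma divided_diff_uniq l p q :
  q * linform (root_form l) = p - poly_act (refl l) p -> divided_diff l p = q.
Proof.
rewrite -divided_diffE => h; apply: (mulIf (root_form_neq0 xi l)).
by rewrite h.
Qed.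

Lemma divided_diff_is_linear l : linear (divided_diff l).
Proof.
move=> a p q; apply: divided_diff_uniq.
rewrite mulrDl -scalerAl !divided_diffE poly_actD poly_actZ scalerBr.
by rewrite opprD addrACA.
Qed.

Lemma divided_diff_linform l f p :
  divided_diff l (linform f * p) =
  pairing (coroot l) f *: poly_act (refl l) p + linform f * divided_diff l p.
Proof.
apply: divided_diff_uniq.
rewrite mulrDl -mulrA divided_diffE -scalerAl scalerAr -linformZ -(reflE hxi).
by rewrite linformB poly_actM poly_act_linform mulrBr mulrBr addrC addrA
  ![poly_act _ p * _]mulrC subrK.
Qed.

Lemma divided_diff1 l : divided_diff l 1 = 0.
Proof. by apply: divided_diff_uniq; rewrite mul0r poly_act1 subrr. Qed.

Lemma dunkl_is_linear v : linear (dunkl v).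
Proof.
move=> a p q; rewrite /dunkl scalerN -opprD scaler_sumr -big_split; congr (- _).
apply: eq_bigr => l _; rewrite divided_diff_is_linear scalerDr !scalerA.
by congr (_ *: _ + _); rewrite mulrC.
Qed.

Lemma dunkl_linearl p : linear (dunkl ^~ p).
Proof.
move=> a v w; rewrite /dunkl scalerN -opprD scaler_sumr -big_split; congr (- _).
apply: eq_bigr => l _ /=; rewrite pairingDl pairingZl mulrDr scalerDl scalerA.
by congr (_ *: _ + _); rewrite mulrCA.
Qed.

Lemma dunkl1 v : dunkl v 1 = 0.
Proof. by rewrite /dunkl big1 ?oppr0 // => l _; rewrite divided_diff1 scaler0. Qed.

Lemma dunkl_linform v f p :
  dunkl v (linform f * p) - linform f * dunkl v p =
  - \sum_(l < m) (c (refl l) * pairing v (root_form l)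
                   * pairing (coroot l) f) *: poly_act (refl l) p.
Proof.
rewrite /dunkl mulrN opprK addrC mulr_sumr -sumrB -sumrN; apply: eq_bigr => l _.
rewrite divided_diff_linform scalerDr scalerA -scalerAr.
by rewrite opprD addrCA subrr addr0.
Qed.

Hypothesis hc : conj_invariant m c.

Lemma conj_refl (g : 'M[K]_2) : g \in Gmm m ->
  exists2 sigma : 'I_m -> 'I_m, bijective sigma &
    forall l, refl (sigma l) = g *m refl l *m invmx g.
Proof.
move=> gG; have ug := Gmm_unit hxi gG.
have ex (l : 'I_m) : exists k : 'I_m, refl k == g *m refl l *m invmx g.
  have /(reflectionP hxi)[k ->] : reflection m (g *m refl l *m invmx g).
    apply/andP; split; first by rewrite !(GmmM hxi) ?(GmmV hxi) ?(refl_Gmm hxi).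
    have -> : 1%:M - g *m refl l *m invmx g = g *m (1%:M - refl l) *m invmx g.
      by rewrite mulmxBr mulmxBl mulmx1 mulmxV.
    rewrite mxrankMfree ?row_free_unit ?unitmx_inv //.
    rewrite -mxrank_tr trmx_mul mxrankMfree ?row_free_unit ?unitmx_tr // mxrank_tr.
    by case/andP: (reflection_refl hxi l).
  by exists k.
exists (fun l => xchoose (ex l)) => [|l]; last exact/eqP/(xchooseP (ex l)).
apply: injF_bij => l k /(congr1 (fun i : 'I_m => refl i)).
rewrite (eqP (xchooseP (ex l))) (eqP (xchooseP (ex k))) => h.
apply: (refl_inj hxi); move/(congr1 (fun A => invmx g *m (A *m g))): h.
by rewrite !mulmxKV // !mulKmx.
Qed.

Lemma dunkl_act g v p : g \in Gmm m ->
  poly_act g (dunkl v p) = dunkl (g *m v) (poly_act g p).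
Proof.
move=> gG; have ug := Gmm_unit hxi gG.
have [sigma sbij hs] := conj_refl gG.
rewrite /dunkl.
rewrite [X in _ = - X](reindex sigma) /=; last exact: onW_bij.
rewrite poly_actN poly_act_sum; congr (- _).
apply: eq_bigr => l _.
rewrite poly_actZ.
have gs : refl (sigma l) *m g = g *m refl l by rewrite hs mulmxKV.
rewrite {1}hs hc ?reflection_refl // -!scalerA; congr (_ *: _).
apply: (mulIf (root_form_neq0 xi (sigma l))).
rewrite -!scalerAl divided_diffE.
rewrite -(poly_act_mul _ (refl_unit hxi _) ug) gs (poly_act_mul _ ug (refl_unit hxi _)).
rewrite -poly_actB -divided_diffE poly_actM poly_act_linform.
set a := pairing (coroot (sigma l)) (dual_act g (delta_mx 0 0)).
have ga : dual_act g (root_form l) = a *: root_form (sigma l).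
  rewrite -(reflE hxi) -(dual_actM _ (refl_unit hxi _) ug) gs (dual_actM _ ug (refl_unit hxi _)).
  rewrite -[_ - _](_ : dual_act g (delta_mx 0 0 - dual_act (refl l) (delta_mx 0 0)) = _).
    rewrite (reflE hxi) (_ : pairing _ _ = 1) ?scale1r //.
    by rewrite /pairing !mxE big_I2 !mxE /= mulr0 subr0 mul0r addr0 mulr1.
  by rewrite dual_actD -[- dual_act _ _]scaleN1r dual_actZ scaleN1r.
rewrite ga linformZ -(pairing_act v _ ug) ga pairingZr -scalerAr scalerA.
by rewrite mulrC.
Qed.

Lemma dunklC v w p : dunkl v (dunkl w p) = dunkl w (dunkl v p).
Proof.
have DX u f q := canRL (subrK _) (dunkl_linform u f q).
move: dunkl dunkl_is_linear dunkl_linearl dunkl1 dunkl_act DX => D Dr Dl D1 Dg DX.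
have D0 u : D u 0 = 0.
  by have := Dr u (-1) 0 0; rewrite scaleN1r oppr0 addr0 scaleN1r addNr.
have Da u q r : D u (q + r) = D u q + D u r by rewrite -[q]scale1r Dr !scale1r.
have Dz u a q : D u (a *: q) = a *: D u q by rewrite -[X in D u X]addr0 Dr D0 addr0.
move: p; apply: mpoly_lin_ind => [|p q hp hq|a p hp|f p hp].
- by rewrite !D1 !D0.
- by rewrite !Da hp hq.
- by rewrite !Dz hp.
have DN u q : D u (- q) = - D u q by rewrite -scaleN1r Dz scaleN1r.
have Ds u (F : 'I_m -> {mpoly K[2]}) : D u (\sum_(l < m) F l) = \sum_(l < m) D u (F l).
  by elim/big_rec2: _ => [|l q r _ <-]; rewrite ?D0 ?Da.
pose T u q : {mpoly K[2]} := \sum_(l < m) (c (refl l) * pairing u (root_form l)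
                 * pairing (coroot l) f) *: poly_act (refl l) q.
have DT u q : D u (linform f * q) = - T u q + linform f * D u q by exact: DX.
suff main : D v (T w p) + T v (D w p) = D w (T v p) + T w (D v p).
  rewrite (DT w p) (DT v p) !Da (DT v (D w p)) (DT w (D v p)) hp !DN.
  by rewrite (addrA (- D v _)) (addrA (- D w _)) -!opprD main.
rewrite /T !Ds -!big_split /=; apply: eq_bigr => l _.
rewrite !Dz !Dg ?refl_Gmm //; move: (poly_act _ p) => q.
have Dv u : D (refl l *m u) q = D u q - pairing u (root_form l) *: D (coroot l) q.
  have -> : refl l *m u = (- pairing u (root_form l)) *: coroot l + u.
    by rewrite scaleNr -(reflE_h hxi) opprB subrK.
  by rewrite Dl scaleNr addrC.
rewrite !Dv; set a := c _; set b := pairing v _; set b' := pairing w _; set d := pairing _ f.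
rewrite !scalerBr !scalerA [RHS]addrC -!addrA; congr (_ + _); rewrite addrC.
by congr (_ - _ *: _); rewrite -!mulrA; congr (_ * _); rewrite mulrCA [RHS]mulrCA (mulrC b).
Qed.

Fact verma_actG_linear g : g \in Gmm m -> linear (@poly_act K 2 g).
Proof. by move=> _ a p q; rewrite poly_actD poly_actZ. Qed.

Fact verma_actX_linear f : linear (fun p : {mpoly K[2]} => linform f * p).
Proof. by move=> a p q; rewrite mulrDr scalerAr. Qed.

Fact verma_actX_linearl (p : {mpoly K[2]}) :
  linear (fun f : 'rV[K]_2 => linform f * p).
Proof. by move=> a f f'; rewrite linformD linformZ mulrDl scalerAl. Qed.

Fact verma_actGM g h (p : {mpoly K[2]}) : g \in Gmm m -> h \in Gmm m ->
  poly_act (g *m h) p = poly_act g (poly_act h p).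
Proof. by move=> gG hG; rewrite poly_act_mul // (Gmm_unit hxi). Qed.

Fact verma_actGX g f (p : {mpoly K[2]}) : g \in Gmm m ->
  poly_act g (linform f * p) = linform (dual_act g f) * poly_act g p.
Proof. by rewrite poly_actM poly_act_linform. Qed.

Fact verma_actXC f f' (p : {mpoly K[2]}) :
  linform f * (linform f' * p) = linform f' * (linform f * p).
Proof. by rewrite mulrCA. Qed.

(* M(rho_0) = A (x) rho_0 = A; rho_0 sits in degree 0, so the grading is by mdeg. *)
Definition verma : cherednik_module m xi c :=
  @CherednikModule K m xi c {mpoly K[2]}
    (@poly_act K 2) (fun f p => linform f * p) dunkl
    verma_actG_linear verma_actX_linear dunkl_is_linear
    verma_actX_linearl dunkl_linearl
    (@poly_act_id K 2) verma_actGM verma_actGX dunkl_act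
    verma_actXC dunklC dunkl_linform.

Definition proper_graded_submodule (N : {mpoly K[2]} -> Prop) : Prop :=
  [/\ @is_submodule K m xi c verma N,
      (forall i p, N p -> N (pihomog mdeg i p))
    & exists p, ~ N p].

Definition maximal_graded_submodule (J : {mpoly K[2]} -> Prop) : Prop :=
  proper_graded_submodule J /\
  forall N, proper_graded_submodule N ->
    (forall p, J p -> N p) -> forall p, N p -> J p.

End Verma.

Definition ideal_gen (A : comNzRingType) (gens : seq A) (f : A) : Prop :=
  exists u : 'I_(size gens) -> A, f = \sum_i u i * gens`_i.

(* The degree i part of A/J has dimension d: some d homogeneous polynomials of
   degree i are linearly independent and spanning modulo J. *)
Definition quotient_dim (K : fieldType) (n : nat) (J : {mpoly K[n]} -> Prop)
    (i d : nat) : Prop :=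
  exists b : 'I_d -> {mpoly K[n]},
    [/\ (forall k, b k \is i.-homog),
        (forall a : 'I_d -> K, J (\sum_k a k *: b k) -> forall k, a k = 0)
      & (forall f, f \is i.-homog ->
          exists a : 'I_d -> K, J (f - \sum_k a k *: b k))].

Definition hilbert_series (K : fieldType) (n : nat) (J : {mpoly K[n]} -> Prop)
    (h : nat -> nat) : Prop :=
  forall i, quotient_dim J i (h i).

Definition alg_independent (K : fieldType) (p : nat) (s : seq K) : Prop :=
  forall P : {mpoly 'F_p[size s]},
    mmap (fun a : 'F_p => (a : nat)%:R) (fun i => s`_i) P = 0 -> P = 0.

(* One parameter per conjugacy class of reflections: for m even the classes are
   those of refl l with l even and with l odd; for m odd there is only one. *)
Definition generic_parameters (K : fieldType) (p m : nat) (xi : K)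
    (c : 'M[K]_2 -> K) : Prop :=
  alg_independent p
    (if odd m then [:: c (refl xi 0)] else [:: c (refl xi 0); c (refl xi 1)]).

(* Main.v *)
(* Membership in the ideal (xy, x^m + y^m) only depends on the coefficients of
   the pure powers x^i, y^i with i <= m: those with i < m vanish and those of
   x^m and y^m agree. Each divided difference (1 - s)/alpha_s preserves these
   conditions, so the ideal is a proper graded submodule.

   Conversely, put S(z) = sum_l c_l z^l. The coefficient of x^i in D_1 f is
   S(xi^-(i+1)) b - S(1) a and that of y^i in D_2 f is S(xi^(i+1)) a - S(1) b,
   where a, b are the coefficients of x^(i+1), y^(i+1) in f. As c_l only depends
   on the parity of l, S(z) = 0 for z^m = 1 unless z = 1 or -1, and for generic
   parameters S(1)^2 - S(z) S(1/z) is nonzero whenever z^m = 1 and z <> 1. Hence,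
   by induction on i, an f in a proper graded submodule has no pure power of
   degree i < m; for i = m - 1, where both S's equal S(1), the coefficients of
   x^m and y^m agree. *)
From HB Require Import structures.
Require Import Defs.
From mathcomp Require Import all_boot all_order all_algebra.
From mathcomp Require Import mpoly.
From mathcomp Require Import ring.

Set Implicit Arguments.
Unset Strict Implicit.
Unset Printing Implicit Defensive.

Import GRing.Theory.
Local Open Scope ring_scope.

Lemma coef_comp_scaleX (R : comNzRingType) (a : R) (q : {poly R}) i :
  (q \Po (a *: 'X))`_i = a ^+ i * q`_i.
Proof.
rewrite comp_polyE coef_sum.
under eq_bigr => k _ do rewrite exprZn scalerA coefZ coefXn eq_sym.
have [lti|gei] := ltnP i (size q).
  rewrite (bigD1 (Ordinal lti)) //= eqxx mulr1 mulrC big1 ?addr0 // => k.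
  by rewrite -val_eqE /= => /negPf ->; rewrite mulr0.
rewrite nth_default // mulr0 big1 // => k _.
by rewrite (ltn_eqF (leq_trans (ltn_ord k) gei)) mulr0.
Qed.

(** * Nonvanishing of sums of algebraically independent parameters *)

Section Generic.
Variables (K : fieldType) (p : nat).
Hypothesis hp : p \in [pchar K].

(** The coefficient map of [alg_independent], given a name so that it can carry a ring morphism
    structure. *)
Definition Fp_natr (a : 'F_p) : K := (a : nat)%:R.

Lemma natr_mod_pchar n : (n %% p)%:R = n%:R :> K.
Proof.
rewrite [in RHS](divn_eq n p) natrD natrM.
by rewrite (pcharf0 hp) mulr0 add0r.
Qed.

Fact Fp_natr_is_zmod_morphism : zmod_morphism Fp_natr.
Proof.
(* The modulus behind ['F_p] is [(Zp_trunc (pdiv p)).+2], which is [p] because [p] is prime. *)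
have pE : (Zp_trunc (pdiv p)).+2 = p by apply/Fp_cast/(pcharf_prime hp).
have addE a b : Fp_natr (a + b) = Fp_natr a + Fp_natr b.
  by rewrite /Fp_natr /= -natrD [X in (_ %% X)%N]pE natr_mod_pchar.
by move=> a b; apply: (addIr (Fp_natr b)); rewrite -addE !subrK.
Qed.

Fact Fp_natr_is_monoid_morphism : monoid_morphism Fp_natr.
Proof.
have pE : (Zp_trunc (pdiv p)).+2 = p by apply/Fp_cast/(pcharf_prime hp).
split=> [|a b]; first by [].
by rewrite /Fp_natr /= -natrM [X in (_ %% X)%N]pE natr_mod_pchar.
Qed.

HB.instance Definition _ :=
  GRing.isZmodMorphism.Build 'F_p K Fp_natr Fp_natr_is_zmod_morphism.
HB.instance Definition _ :=
  GRing.isMonoidMorphism.Build 'F_p K Fp_natr Fp_natr_is_monoid_morphism.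

(** The sum is the value at [s] of a linear form with coefficients 0 and 1, whose coefficient at any
    index of [A] is 1. *)
Lemma alg_independent_sum_neq0 (s : seq K) (A : {set 'I_(size s)}) :
  alg_independent p s -> A != set0 -> \sum_(i in A) s`_i != 0.
Proof.
move=> hs /set0Pn[i0 Ai0]; apply/eqP => s0.
have /hs : mmap Fp_natr (fun i : 'I_(size s) => s`_i) (\sum_(i in A) 'X_i) = 0.
  by rewrite raddf_sum -[RHS]s0 /=; apply: eq_bigr => i _; rewrite mmapX mmap1U.
move/(congr1 (mcoeff U_(i0))); rewrite raddf_sum /= mcoeff0 (bigD1 i0) //=.
rewrite mcoeffX eqxx big1 ?addr0 => [/eqP|i /andP[_ ne]]; first by rewrite oner_eq0.
by rewrite mcoeffX eq_mnm1 (negPf ne).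
Qed.

Lemma alg_independent1 (a : K) : alg_independent p [:: a] -> a != 0.
Proof.
move=> hs; have := @alg_independent_sum_neq0 [:: a] [set: 'I_1] hs.
rewrite (eq_bigl xpredT) => [|i]; last by rewrite inE.
by rewrite big_ord1; apply; apply/set0Pn; exists 0; rewrite inE.
Qed.

Lemma alg_independent2 (a b : K) : alg_independent p [:: a; b] ->
  [/\ a != 0, b != 0 & a + b != 0].
Proof.
move=> hs; have h (A : {set 'I_2}) : A != set0 -> \sum_(i in A) [:: a; b]`_i != 0 :> K
  := @alg_independent_sum_neq0 [:: a; b] A hs.
split.
- have := h [set 0]; rewrite big_set1; apply.
  by apply/set0Pn; exists 0; rewrite inE.
- have := h [set 1]; rewrite big_set1; apply.
  by apply/set0Pn; exists 1; rewrite inE.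
- have := h setT; rewrite (eq_bigl xpredT) => [|i]; last by rewrite inE.
  by rewrite big_I2; apply; apply/set0Pn; exists 0; rewrite inE.
Qed.

End Generic.

(** * Restriction to the coordinate axes and closure properties of [maxJ] *)

Section Axis.
Variable K : fieldType.
Implicit Types (p q : {mpoly K[2]}) (j k : 'I_2).

(** Restriction to the [j]-th coordinate axis. Being a ring morphism, it gives access to the
    coefficients of pure powers without handling multi-indices. *)
Definition axis j : {mpoly K[2]} -> {poly K} :=
  mmap (@polyC K) (fun i => if i == j then 'X else 0).

HB.instance Definition _ j := GRing.RMorphism.copy (axis j)
  (mmap (@polyC K) (fun i => if i == j then 'X else 0)).

Lemma axisZ j a p : axis j (a *: p) = a *: axis j p.
Proof. by rewrite /axis mmapZ mul_polyC. Qed.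

Lemma axisXi j i : axis j 'X_i = if i == j then 'X else 0.
Proof. by rewrite /axis mmapX mmap1U. Qed.

Lemma ord2P (i : 'I_2) : i = 0 \/ i = 1.
Proof. by case: i => [[|[|i]] hi] //; [left|right]; apply: val_inj. Qed.

Lemma axis_linform j f : axis j (linform f) = f 0 j *: 'X.
Proof.
rewrite /linform raddf_sum /= (bigD1 j) //= axisZ axisXi eqxx big1 ?addr0 // => i.
by rewrite axisZ axisXi => /negPf ->; rewrite scaler0.
Qed.

Lemma axis_coef j p i : (axis j p)`_i = p@_(U_(j) *+ i).
Proof.
elim/mpolyind: p => [|a u p _ _ IH]; first by rewrite rmorph0 coef0 mcoeff0.
rewrite rmorphD /= coefD mcoeffD IH axisZ coefZ mcoeffZ mcoeffX; congr (_ * _ + _).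
rewrite /axis mmapX /mmap1 big_I2.
have -> : (u == (U_(j) *+ i)%MM) = [forall k, u k == ((k == j) * i)%N].
  apply/eqP/forallP => [-> k|h]; first by rewrite mulmnE mnm1E (eq_sym j).
  by apply/mnmP => k; rewrite (eqP (h k)) mulmnE mnm1E (eq_sym j).
rewrite forall2; case: (ord2P j) => ->; rewrite !eqxx /= ?mul0n ?mul1n expr0n.
  by case: (u 1 == 0%N); rewrite /= ?mulr1 ?mulr0 ?coef0 ?andbF // coefXn eq_sym andbT.
by case: (u 0 == 0%N); rewrite /= ?mul1r ?mul0r ?coef0 // coefXn eq_sym.
Qed.

Lemma coef_axisD j p q i : (axis j (p + q))`_i = (axis j p)`_i + (axis j q)`_i.
Proof. by rewrite rmorphD coefD. Qed.

Lemma coef_axisB j p q i : (axis j (p - q))`_i = (axis j p)`_i - (axis j q)`_i.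
Proof. by rewrite rmorphB coefB. Qed.

Lemma coef_axisZ j a p i : (axis j (a *: p))`_i = a * (axis j p)`_i.
Proof. by rewrite axisZ coefZ. Qed.

Lemma coef_axis1 j i : (axis j 1)`_i = (i == 0%N)%:R.
Proof. by rewrite rmorph1 coef1. Qed.

Lemma coef_axisXn j k n i : (0 < n)%N ->
  (axis j ('X_k ^+ n))`_i = ((k == j) && (i == n))%:R.
Proof.
move=> n0; rewrite rmorphXn /= axisXi; case: (k == j); first by rewrite coefXn.
by rewrite expr0n eqn0Ngt n0 coef0.
Qed.

(** Monomial matrices permute the axes up to scaling, which is the hypothesis. Both sides are linear
    and multiplicative in [p], so linear forms suffice. *)
Lemma axis_act g j k a p : (forall f, dual_act g f 0 j = a * f 0 k) ->
  axis j (poly_act g p) = axis k p \Po (a *: 'X).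
Proof.
move=> h; move: p; apply: mpoly_lin_ind => [|p q hp hq|b p hp|f p hp].
- by rewrite poly_act1 !rmorph1.
- by rewrite poly_actD !rmorphD /= hp hq.
- by rewrite poly_actZ !axisZ hp comp_polyZ.
- rewrite poly_actM poly_act_linform !rmorphM /= hp !axis_linform h.
  by rewrite comp_polyZ comp_polyX scalerA mulrC [a * _]mulrC mulrC.
Qed.

Lemma axis_pihomog j d p i :
  (axis j (pihomog mdeg d p))`_i = (axis j p)`_i *+ (i == d).
Proof.
elim/mpolyind: p => [|a u p _ _ IH].
  by rewrite pihomog0 !rmorph0 coef0 mul0rn.
rewrite linearP /= !rmorphD /= !coefD IH mulrnDl !axisZ !coefZ -mulrnAr.
congr (_ * _ + _); rewrite pihomogX !axis_coef mcoeffX.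
have dE : mdeg (U_(j) *+ i) = i by rewrite mdegMn mdeg1 mul1n.
case: (mdeg u =P d) => [ud|ud]; rewrite ?mcoeffX ?mcoeff0;
  case: eqVneq => [uE|_]; rewrite ?mul0rn //; case: eqVneq => // id.
  by case/eqP: id; rewrite -ud uE dE.
by case: ud; rewrite uE dE.
Qed.

(* The ideal (xy, x^m + y^m), see [maxJ_ideal]. *)
Definition maxJ m p : Prop :=
  (forall i j, (i < m)%N -> (axis j p)`_i = 0) /\ (axis 0 p)`_m = (axis 1 p)`_m.

Variable m : nat.

Lemma maxJ0 : maxJ m 0.
Proof. by split=> [i j _|]; rewrite !rmorph0 !coef0. Qed.

Lemma maxJD p q : maxJ m p -> maxJ m q -> maxJ m (p + q).
Proof.
move=> [h1 h2] [h3 h4]; split=> [i j lti|]; rewrite !coef_axisD.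
  by rewrite h1 ?h3 ?addr0.
by rewrite h2 h4.
Qed.

Lemma maxJZ a p : maxJ m p -> maxJ m (a *: p).
Proof.
move=> [h1 h2]; split=> [i j lti|]; rewrite !coef_axisZ; first by rewrite h1 ?mulr0.
by rewrite h2.
Qed.

Lemma maxJ_linform f p : (0 < m)%N -> maxJ m p -> maxJ m (linform f * p).
Proof.
(* Multiplication by a linear form raises degrees by one, so pure powers of degree [m] vanish too
   and the last condition reads 0 = 0. *)
move=> m0 [h1 h2]; have h i j : (i <= m)%N -> (axis j (linform f * p))`_i = 0.
  move=> lei; rewrite rmorphM /= axis_linform -scalerAl coefZ coefXM.
  by case: i lei => [|i] lei; rewrite ?mulr0 //= h1 ?mulr0.
by split=> [i j lti|]; rewrite !h // ltnW.
Qed.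

Lemma maxJ_mull q p : (0 < m)%N -> maxJ m p -> maxJ m (q * p).
Proof.
move=> m0 hp; move: q; apply: mpoly_lin_ind => [|q q' hq hq'|a q hq|f q hq].
- by rewrite mul1r.
- by rewrite mulrDl; apply: maxJD.
- by rewrite -scalerAl; apply: maxJZ.
- by rewrite -mulrA; apply: maxJ_linform.
Qed.

Lemma maxJ_sum (I : Type) (r : seq I) (F : I -> {mpoly K[2]}) :
  (forall i, maxJ m (F i)) -> maxJ m (\sum_(i <- r) F i).
Proof. by move=> h; elim/big_ind: _ => // [|p q]; [apply: maxJ0|apply: maxJD]. Qed.

Lemma maxJ_pihomog d p : maxJ m p -> maxJ m (pihomog mdeg d p).
Proof.
move=> [h1 h2]; split=> [i j lti|]; rewrite !axis_pihomog; first by rewrite h1 ?mul0rn.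
by rewrite h2.
Qed.

Lemma maxJ1 : (0 < m)%N -> ~ maxJ m 1.
Proof. by move=> m0 [/(_ 0%N 0 m0)]; rewrite coef_axis1 => /eqP; rewrite oner_eq0. Qed.

Lemma maxJ_act g p : (0 < m)%N -> g \in Gmm m -> maxJ m p -> maxJ m (poly_act g p).
Proof.
move=> m0 /(GmmP _ m0)[a ham gE] [h1 h2].
have a0 : a != 0 by apply: contra_eq_neq ham => ->; rewrite expr0n eqn0Ngt m0 /= eq_sym oner_eq0.
have Vham : a^-1 ^+ m = 1 by rewrite exprVn ham invr1.
have [rotV swpV] : invmx (rot_mx a) = rot_mx a^-1 /\ invmx (swp_mx a) = swp_mx a.
  by split; apply: invmxE; apply: eq_mx2; rewrite !mxE !big_I2 !mxE /=
    ?(mulr0, mul0r, mulr1, addr0, add0r) ?divff ?mulVf ?invr_eq0.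
(* [s] and [t] are the axes whose coefficients land on axes 0 and 1: kept by [rot_mx], exchanged by
   [swp_mx]. In degree [m] the scaling factors are [a ^+ m] and its inverse, both 1. *)
have E s t : (forall f, dual_act g f 0 0 = a^-1 * f 0 s) ->
             (forall f, dual_act g f 0 1 = a * f 0 t) ->
    (axis 0 p)`_m = (axis s p)`_m -> (axis 0 p)`_m = (axis t p)`_m -> maxJ m (poly_act g p).
  move=> e0 e1 hs ht; have A0 := axis_act p e0; have A1 := axis_act p e1; split.
    by move=> i j lti; case: (ord2P j) => ->; rewrite ?A0 ?A1 coef_comp_scaleX h1 ?mulr0.
  by rewrite A0 A1 !coef_comp_scaleX ham Vham !mul1r -hs -ht.
case: gE => gE; [apply: (E 0 1)|apply: (E 1 0)]; rewrite ?h2 // => f;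
  by rewrite /dual_act gE ?rotV ?swpV !mxE !big_I2 !mxE /= ?invrK
     ?(mulr0, mul0r, mulr1, addr0, add0r) mulrC.
Qed.

End Axis.

(** * Dunkl operators on the coefficients of pure powers *)

Section Dunkl.
Variables (K : fieldType) (m : nat) (xi : K) (c : 'M[K]_2 -> K).
Hypothesis hxi : m.-primitive_root xi.
Let m0 : (0 < m)%N := prim_order_gt0 hxi.
Implicit Types (p q : {mpoly K[2]}).

Lemma dual_act_refl0 l f : dual_act (refl xi l) f 0 0 = xi ^- l * f 0 1.
Proof.
rewrite /dual_act (invmx_refl hxi) !mxE big_I2 !mxE /=.
by rewrite !(mulr0, addr0, add0r, mulr1) mulrC.
Qed.

Lemma dual_act_refl1 l f : dual_act (refl xi l) f 0 1 = xi ^+ l * f 0 0.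
Proof.
rewrite /dual_act (invmx_refl hxi) !mxE big_I2 !mxE /=.
by rewrite !(mulr0, addr0, add0r, mulr1) mulrC.
Qed.

(** Restrict the equation defining the quotient to axis 0, where [root_form l] becomes ['X], and
    compare coefficients in degree [i.+1]. *)
Lemma coef_divided_diff0 l p i :
  (axis 0 (divided_diff hxi l p))`_i =
  (axis 0 p)`_i.+1 - xi ^- l ^+ i.+1 * (axis 1 p)`_i.+1.
Proof.
have /(congr1 (fun q => (axis 0 q)`_i.+1)) := divided_diffE hxi l p.
rewrite rmorphM rmorphB /= (axis_act _ (dual_act_refl0 l)) axis_linform.
rewrite coefB coef_comp_scaleX -scalerAr coefZ coefMX /= !mxE /=.
by rewrite mulr0 subr0 mul1r.
Qed.

(** On axis 1 the form [root_form l] becomes [- xi ^+ l *: 'X]; dividing by it gives the factor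
    [xi ^- l] and the sign. *)
Lemma coef_divided_diff1 l p i :
  (axis 1 (divided_diff hxi l p))`_i =
  xi ^- l * (xi ^+ l ^+ i.+1 * (axis 0 p)`_i.+1 - (axis 1 p)`_i.+1).
Proof.
have /(congr1 (fun q => (axis 1 q)`_i.+1)) := divided_diffE hxi l p.
rewrite rmorphM rmorphB /= (axis_act _ (dual_act_refl1 l)) axis_linform.
rewrite coefB coef_comp_scaleX -scalerAr coefZ coefMX /= !mxE /=.
rewrite mulr1 sub0r mulNr => h.
by rewrite -[_ - _ in RHS]opprB -h opprK mulKf // (xiX_neq0 hxi).
Qed.

Lemma maxJ_divided_diff l p : maxJ m p -> maxJ m (divided_diff hxi l p).
Proof.
move=> [h1 h2].
have zm : xi ^+ l ^+ m = 1 by rewrite exprAC (prim_expr_order hxi) expr1n.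
have z0 := xiX_neq0 hxi l.
split=> [i j lti|].
  have [lti1|] := ltnP i.+1 m.
    by case: (ord2P j) => ->; rewrite ?coef_divided_diff0 ?coef_divided_diff1
      !h1 ?mulr0 ?subr0 ?mulr0.
  (* Here [i.+1 = m]: the two coefficients of [p] agree and [xi ^+ l ^+ m = 1], so they cancel. *)
  rewrite leq_eqVlt ltnNge lti orbF => /eqP mE.
  by case: (ord2P j) => ->; rewrite ?coef_divided_diff0 ?coef_divided_diff1
    -mE ?exprVn zm h2 ?invr1 mul1r subrr ?mulr0.
(* With [a], [b] the coefficients of degree [m.+1] on the two axes, both sides equal
   [a - xi ^- l * b]. *)
rewrite coef_divided_diff0 coef_divided_diff1 !exprS !exprVn zm.
by rewrite invr1 !mulr1 mulrBr mulKf.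
Qed.

Lemma maxJ_dunkl v p : maxJ m p -> maxJ m (dunkl c hxi v p).
Proof.
move=> hp; rewrite /dunkl -scaleN1r; apply/maxJZ/maxJ_sum => l.
exact/maxJZ/maxJ_divided_diff.
Qed.

(** The sum S of the overview: for [z ^+ m = 1], a discrete Fourier transform of the parameters. *)
Definition param_sum (z : K) : K := \sum_(l < m) c (refl xi l) * z ^+ l.


Lemma coef_dunkl0 p i :
  (axis 0 (dunkl c hxi (delta_mx 0 0) p))`_i =
  param_sum (xi ^- i.+1) * (axis 1 p)`_i.+1 - param_sum 1 * (axis 0 p)`_i.+1.
Proof.
rewrite /dunkl rmorphN rmorph_sum coefN coef_sum /= /param_sum !mulr_suml -sumrB.
rewrite -sumrN; apply: eq_bigr => l _; rewrite axisZ coefZ coef_divided_diff0.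
rewrite /pairing !mxE big_I2 !mxE /= expr1n exprVn -!exprM mulnC exprVn -exprM; ring.
Qed.

(** The pairing of [delta_mx 1 0] with [root_form l] is [- xi ^+ l], which cancels the factor
    [xi ^- l] of [coef_divided_diff1]. *)
Lemma coef_dunkl1 p i :
  (axis 1 (dunkl c hxi (delta_mx 1 0) p))`_i =
  param_sum (xi ^+ i.+1) * (axis 0 p)`_i.+1 - param_sum 1 * (axis 1 p)`_i.+1.
Proof.
rewrite /dunkl rmorphN rmorph_sum coefN coef_sum /= /param_sum !mulr_suml -sumrB.
rewrite -sumrN; apply: eq_bigr => l _; rewrite axisZ coefZ coef_divided_diff1.
rewrite /pairing !mxE big_I2 !mxE /= expr1n [xi ^+ i.+1 ^+ l]exprAC.
by have := xiX_neq0 hxi l; set z := xi ^+ l => z0; field.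
Qed.

(** * Values of [param_sum] at roots of unity *)

Hypothesis hc : conj_invariant m c.

(* Conjugation by diag(xi, xi^-1) sends refl l to refl (l + 2). *)
Lemma param_period l : c (refl xi l.+2) = c (refl xi l).
Proof.
have x0 := xiX_neq0 hxi 1; rewrite expr1 in x0.
have rG : rot_mx xi \in Gmm m by apply/GmmP => //; exists xi; [exact: prim_expr_order|left].
rewrite -(hc rG (reflection_refl hxi l)); congr c.
have -> : invmx (rot_mx xi) = rot_mx xi^-1.
  by apply: invmxE; apply: eq_mx2; rewrite !mxE !big_I2 !mxE /=
    ?(mulr0, mul0r, mulr1, addr0, add0r) ?divff ?mulVf ?invr_eq0.
apply: eq_mx2; rewrite !mxE !big_I2 !mxE /= !big_I2 !mxE /= ?invrK
  !(mulr0, mul0r, mulr1, mul1r, addr0, add0r) //.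
  by rewrite !exprS mulrAC mulrA.
by rewrite !exprS !invfM mulrAC mulrA.
Qed.

(** The summand is [m]-periodic in [l], so the index may be shifted by 2, which leaves the
    parameters unchanged. *)
Lemma param_sum_shift z : z ^+ m = 1 -> z ^+ 2 * param_sum z = param_sum z.
Proof.
move=> zm; have F l : c (refl xi (l + m)) = c (refl xi l).
  by rewrite /refl exprD (prim_expr_order hxi) mulr1.
pose G l := c (refl xi l) * z ^+ l.
have E n : \sum_(n <= l < n + m) G l = \sum_(0 <= l < m) G l.
  elim: n => [|n <-]; first by rewrite add0n.
  rewrite addSn [RHS]big_ltn; last by rewrite -addn1 leq_add2l.
  rewrite big_nat_recr /=; last by rewrite -addn1 leq_add2l.
  by rewrite addrC {1}/G F exprD zm mulr1.
have E2 : \sum_(0 <= l < m) G (l + 2)%N = \sum_(0 <= l < m) G l.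
  by rewrite -[RHS](E 2%N) -[X in _ = \sum_(X <= _ < _) _]add0n big_addn addKn.
rewrite /param_sum -(big_mkord xpredT G) -[RHS]E2 mulr_sumr.
by apply: eq_bigr => l _; rewrite /G addn2 param_period !exprS; ring.
Qed.

Lemma param_sum_eq0 z : z ^+ m = 1 -> z ^+ 2 != 1 -> param_sum z = 0.
Proof.
move=> zm z2; apply/eqP; have /eqP := param_sum_shift zm.
rewrite -subr_eq0 -[X in _ - X]mul1r -mulrBl mulf_eq0 subr_eq0 (negPf z2).
by [].
Qed.

Lemma sum_even (F : nat -> K) k :
  \sum_(l < k.*2) F l = \sum_(l < k) (F l.*2 + F l.*2.+1).
Proof.
elim: k => [|k IH]; first by rewrite !big_ord0.
by rewrite doubleS !big_ord_recr /= IH addrA.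
Qed.

Lemma param_double l b : c (refl xi (l.*2 + b)) = c (refl xi b).
Proof. by elim: l => [//|l IH]; rewrite doubleS !addSn param_period. Qed.

(** The factor 2 lets the right side involve [m] instead of [m./2]. *)
Lemma param_sum1_even : ~~ odd m ->
  2%:R * param_sum 1 = m%:R * (c (refl xi 0) + c (refl xi 1)).
Proof.
move=> om; have mE : m = m./2.*2 by rewrite even_halfK.
rewrite /param_sum mE (sum_even (fun l => c (refl xi l) * 1 ^+ l)).
under eq_bigr => l _ do
  rewrite !expr1n !mulr1 -[l.*2]addn0 param_double addn0 -addn1 param_double.
rewrite big_const_ord iter_addr_0 -mul2n natrM -mulrA; congr (_ * _).
by rewrite mulr_natl.
Qed.

Lemma param_sumN1_even : ~~ odd m ->
  2%:R * param_sum (-1) = m%:R * (c (refl xi 0) - c (refl xi 1)).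
Proof.
move=> om; have mE : m = m./2.*2 by rewrite even_halfK.
rewrite /param_sum mE (sum_even (fun l => c (refl xi l) * (-1) ^+ l)).
under eq_bigr => l _ do
  rewrite exprS -[(-1) ^+ _]signr_odd odd_double expr0 !mulr1 mulrN1
    -[l.*2]addn0 param_double addn0 -addn1 param_double.
rewrite big_const_ord iter_addr_0 -mul2n natrM -mulrA; congr (_ * _).
by rewrite mulr_natl.
Qed.

Lemma param_sum1_odd : odd m -> param_sum 1 = m%:R * c (refl xi 0).
Proof.
(* For odd [m], going up by twos from 1 reaches [m], and [refl xi m = refl xi 0]. *)
move=> om; have c10 : c (refl xi 1) = c (refl xi 0).
  have := param_double m./2 1; rewrite addn1 -add1n => <-.
  by rewrite -[1%N]/(nat_of_bool true) -om odd_double_half /refl (prim_expr_order hxi).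
have cE l : c (refl xi l) = c (refl xi 0).
  by rewrite -[l]odd_double_half addnC param_double; case: (odd l).
rewrite /param_sum; under eq_bigr => l _ do rewrite expr1n mulr1 cE.
by rewrite big_const_ord iter_addr_0 mulr_natl.
Qed.

(** * Generic parameters: every proper graded submodule lies in [maxJ m] *)

Section GenericParameters.
Variable p : nat.
Hypotheses (hp : p \in [pchar K]) (hpm : ~~ (p %| m)%N) (hp2 : p <> 2%N).
Hypothesis hgen : generic_parameters p m xi c.

Let m_neq0 : m%:R != 0 :> K.
Proof. by rewrite -(dvdn_pcharf hp). Qed.

Let two_neq0 : 2%:R != 0 :> K.
Proof.
rewrite -(dvdn_pcharf hp) dvdn_prime2 // ?(pcharf_prime hp) //.
exact/eqP.
Qed.

Lemma param_sum1_neq0 : param_sum 1 != 0.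
Proof.
move: hgen; rewrite /generic_parameters; case: ifPn => om.
  by move/(alg_independent1 hp) => c0; rewrite param_sum1_odd // mulf_neq0.
case/(alg_independent2 hp) => _ _ cd.
by apply: contraNneq (mulf_neq0 m_neq0 cd) => s0; rewrite -param_sum1_even // s0 mulr0.
Qed.

(** The difference of the two sides is, up to sign, the determinant of the system for the two
    pure-power coefficients. If [z ^+ 2 != 1] the right side is zero; otherwise [z = -1] and [m] is
    even. *)
Lemma param_sum_det_neq0 z : z ^+ m = 1 -> z != 1 ->
  param_sum 1 ^+ 2 != param_sum z * param_sum z^-1.
Proof.
move=> zm z1; have [z2|z2] := eqVneq (z ^+ 2) 1; last first.
  by rewrite (param_sum_eq0 zm z2) mul0r expf_neq0 // param_sum1_neq0.
have zN : z = -1.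
  by apply/eqP; move/eqP: z2; rewrite sqrf_eq1 (negPf z1).
have om : ~~ odd m.
  apply: contraNN two_neq0 => om; move/eqP: zm.
  by rewrite zN -signr_odd om expr1 eq_sym -subr_eq0 opprK.
move: hgen; rewrite /generic_parameters (negPf om) => /(alg_independent2 hp)[c0 c1 _].
rewrite zN invrN1 -subr_eq0.
have four : (2%:R * 2%:R : K) != 0 by rewrite mulf_neq0.
(* This is [(c0 + c1) ^+ 2 - (c0 - c1) ^+ 2 = 4 * c0 * c1], scaled by [m ^+ 2]. *)
have E : 2%:R * 2%:R * (param_sum 1 ^+ 2 - param_sum (-1) * param_sum (-1)) =
    2%:R * 2%:R * (m%:R * m%:R * (c (refl xi 0) * c (refl xi 1))).
  transitivity ((2%:R * param_sum 1) ^+ 2 - (2%:R * param_sum (-1)) ^+ 2); first by ring.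
  by rewrite param_sum1_even // param_sumN1_even //; ring.
by rewrite (mulfI four E) !mulf_neq0.
Qed.

Lemma proper_sub_maxJ N : proper_graded_submodule hxi hc N ->
  forall q, N q -> maxJ m q.
Proof.
case=> -[[N0 ND NZ] [_ NX NY]] Ngr [q0 Nq0].
(* Linear forms generate all of A from [1]. *)
have N1 : ~ N 1.
  by move=> N1; apply/Nq0; move: q0 {Nq0}; apply: mpoly_lin_ind => // f q; apply: NX.
(* The degree 0 part of [q] is a constant lying in [N]; a nonzero one would put [1] in [N]. *)
have cst j q : N q -> (axis j q)`_0 = 0.
  move=> /(Ngr 0%N) Nq; apply/eqP; apply: contra_notT N1 => q1.
  have qE : pihomog mdeg 0 q = (axis j q)`_0 *: 1.
    apply/mpolyP => u; rewrite mcoeffZ mcoeff1 axis_coef mulm0n.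
    have [->|u0] := eqVneq u 0%MM.
      by rewrite -(mulm0n U_(j)) -axis_coef axis_pihomog axis_coef mulm0n mulr1.
    by rewrite mulr0 (dhomog_nemf_coeff (pihomogP _ _ _)) // mdeg_eq0.
  by rewrite -[1](scalerK q1) -qE; apply: NZ.
have low i : (i < m)%N -> forall q, N q -> (axis 0 q)`_i = 0 /\ (axis 1 q)`_i = 0.
  elim: i => [|i IH] lti q Nq; first by rewrite !cst.
  have [/= e0 _] := IH (ltnW lti) _ (NY (delta_mx 0 0) _ Nq).
  have [/= _ e1] := IH (ltnW lti) _ (NY (delta_mx 1 0) _ Nq).
  move: e0 e1; rewrite coef_dunkl0 coef_dunkl1.
  have zm : xi ^+ i.+1 ^+ m = 1 by rewrite exprAC (prim_expr_order hxi) expr1n.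
  have z1 : xi ^+ i.+1 != 1.
    by rewrite -(prim_order_dvd hxi) gtnNdvd.
  move: (param_sum_det_neq0 zm z1); set s := param_sum 1; set t := param_sum _.
  set r := param_sum _; set A := (axis 0 q)`_ _; set B := (axis 1 q)`_ _ => d e0 e1.
  rewrite -subr_eq0 in d.
  (* Cramer's rule for the system [r * B - s * A = 0], [t * A - s * B = 0]. *)
  have hA : A = (- s * (r * B - s * A) - r * (t * A - s * B)) / (s ^+ 2 - t * r) by field.
  have hB : B = (- t * (r * B - s * A) - s * (t * A - s * B)) / (s ^+ 2 - t * r) by field.
  by split; [rewrite hA|rewrite hB]; rewrite e0 e1 !mulr0 subrr mul0r.
move=> q Nq; split=> [i j lti|].
  by have [h0 h1] := low i lti q Nq; case: (ord2P j) => ->.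
have mE : m.-1.+1 = m by rewrite prednK.
have := low m.-1; rewrite mE => /(_ (leqnn _) _ (NY (delta_mx 0 0) _ Nq)) [/= e0 _].
move: e0; rewrite coef_dunkl0 mE (prim_expr_order hxi) invr1 -mulrBr => /eqP.
by rewrite mulf_eq0 (negPf param_sum1_neq0) subr_eq0 => /eqP.
Qed.

End GenericParameters.

Lemma maxJ_proper : proper_graded_submodule hxi hc (maxJ m).
Proof.
split; last by exists 1; apply: maxJ1.
  split; split; [exact: maxJ0|exact: maxJD|exact: maxJZ| | |].
  - by move=> g u; apply: maxJ_act.
  - by move=> f u; apply: maxJ_linform.
  - by move=> v u; apply: maxJ_dunkl.
by move=> i p; apply: maxJ_pihomog.
Qed.

End Dunkl.

Lemma ideal_gen2P (A : comNzRingType) (a b f : A) :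
  ideal_gen [:: a; b] f <-> exists u v, f = u * a + v * b.
Proof.
split=> [[u ->]|[u [v ->]]].
  by exists (u 0), (u 1); rewrite big_I2.
by exists (fun i => if i == 0 then u else v); rewrite big_I2.
Qed.

(** * Identification of [maxJ m] with the ideal, and the Hilbert series *)

Section Ideal.
Variables (K : fieldType) (m : nat).
Hypothesis m0 : (0 < m)%N.
Implicit Types f q : {mpoly K[2]}.
Let x : {mpoly K[2]} := 'X_0.
Let y : {mpoly K[2]} := 'X_1.
Let J f := exists u v, f = u * (x * y) + v * (x ^+ m + y ^+ m).

Let JD f q : J f -> J q -> J (f + q).
Proof. by move=> [u [v ->]] [u' [v' ->]]; exists (u + u'), (v + v'); ring. Qed.

Let JM q f : J f -> J (q * f).
Proof. by move=> [u [v ->]]; exists (q * u), (q * v); ring. Qed.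

Let mpolyX2 (u : 'X_{1..2}) : 'X_[u] = x ^+ u 0 * y ^+ u 1.
Proof. by rewrite mpolyXE_id big_I2. Qed.

Lemma monomial_in_ideal (u : 'X_{1..2}) :
  (0 < u 0%R)%N && (0 < u 1%R)%N || (m < mdeg u)%N -> J 'X_[u].
Proof.
(* Subtracting [b ^+ (k - m)] times the second generator from [b ^+ k] leaves
   [- a ^+ m * b ^+ (k - m)], a multiple of [a * b] since both exponents are positive. *)
have E (a b : {mpoly K[2]}) k : (m < k)%N ->
    b ^+ k = - (a ^+ m.-1 * b ^+ (k - m).-1) * (a * b) + b ^+ (k - m) * (a ^+ m + b ^+ m).
  move=> mk; rewrite -{1}(subnK (ltnW mk)); move: mk; rewrite -subn_gt0 => d.
  by case: m (k - m)%N m0 d => // n [//|e] _ _ /=; rewrite exprD !exprS; ring.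
rewrite mdegE big_I2 mpolyX2; case: (u 0) (u 1) => [|i] [|k] //=.
- by rewrite add0n mul1r => /(E x y) ->; eexists; eexists.
- by rewrite addn0 mulr1 => /(E y x) ->; rewrite [y * x]mulrC [y ^+ m + _]addrC; eexists; eexists.
- by move=> _; exists (x ^+ i * y ^+ k), 0; rewrite !exprS; ring.
Qed.

(* Hides the powers behind a variable [P]: unification unfolds [^+] when a
   rewrite with [coef_axisD] meets [axis j ('X_k ^+ n)]. *)
Lemma axis_powers n : (0 < n)%N -> exists P : 'I_2 -> {mpoly K[2]},
  [/\ forall k, P k = 'X_k ^+ n, forall k, P k \is n.-homog
    & forall j k i, (axis j (P k))`_i = ((k == j) && (i == n))%:R].
Proof.
move=> n0; exists (fun k => 'X_k ^+ n); split=> // [k|j k i]; last exact: coef_axisXn.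
by rewrite mpolyXn dhomogX /= mdegMn mdeg1 mul1n.
Qed.

Lemma maxJ_ideal f : maxJ m f <-> ideal_gen [:: x * y; x ^+ m + y ^+ m] f.
Proof.
apply: iff_trans (iff_sym (ideal_gen2P _ _ _)).
have [P [PX _ ax]] := axis_powers m0; rewrite -!PX.
have Jxy : maxJ m (x * y).
  have xy0 j : axis j (x * y) = 0.
    by rewrite rmorphM /= !axisXi; case: (ord2P j) => ->; rewrite ?mulr0 ?mul0r.
  by split=> [i j lti|]; rewrite !xy0 !coef0.
have Jm : maxJ m (P 0 + P 1).
  split=> [i j lti|]; rewrite !coef_axisD !ax; first by rewrite (ltn_eqF lti) !andbF addr0.
  by rewrite !eqxx /= addr0 add0r.
split=> [[h1 h2]|[u [v ->]]]; last by apply: maxJD; apply: maxJ_mull.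
(* Removing the common coefficient [k] leaves [g] without pure powers of degree at most [m], so
   [monomial_in_ideal] applies to each of its monomials. *)
set k := (axis 0 f)`_m; set g := f - k *: (P 0 + P 1).
have -> : f = g + k%:MP * (P 0 + P 1) by rewrite mul_mpolyC /g subrK.
rewrite !PX; apply: JD; last by apply: JM; exists 0, 1; ring.
have gax j i : (i <= m)%N -> (axis j g)`_i = 0.
  move=> lei; rewrite coef_axisB coef_axisZ coef_axisD !ax.
  case: (ltngtP i m) lei => // [lti|->] _; first by rewrite !andbF addr0 mulr0 subr0 h1.
  by case: (ord2P j) => ->; rewrite /= ?(addr0, add0r) mulr1 -?h2 subrr.
rewrite [g]mpolyE big_seq; elim/big_ind: _ => // [|u]; first by exists 0, 0; ring.
rewrite mcoeff_msupp -mul_mpolyC => gu; apply/JM/monomial_in_ideal.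
apply: contraNT gu; rewrite negb_or negb_and -!eqn0Ngt -leqNgt => /andP[u01 lem].
have [j uE] : exists j, u = (U_(j) *+ mdeg u)%MM.
  rewrite mdegE big_I2; case/orP: u01 => /eqP u0; [exists 1|exists 0];
  apply/mnmP => i; rewrite mulmnE mnm1E; case: (ord2P i) => ->;
  by rewrite /= ?u0 ?addn0 ?mul1n.
by rewrite uE -axis_coef gax.
Qed.

Lemma axis_dhomog j d f i : f \is d.-homog -> i != d -> (axis j f)`_i = 0.
Proof.
move=> hf ne; rewrite axis_coef (dhomog_nemf_coeff hf) //=.
by rewrite mdegMn mdeg1 mul1n.
Qed.

(** The form matches the bases below: 1 in degree 0, 2 strictly between 0 and [m], 1 in degree [m],
    0 above. *)
Lemma coef_hilbert i :
  ((1 + 'X) * (\sum_(k < m) 'X^k) : {poly nat})`_i = ((i < m) + (0 < i <= m))%N.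
Proof.
have E j : (\sum_(k < m) 'X^k : {poly nat})`_j = (j < m)%N.
  rewrite coef_sum; under eq_bigr => k _ do rewrite coefXn.
  have [ltj|gej] := ltnP j m.
    rewrite (bigD1 (Ordinal ltj)) //= eqxx big1 ?addr0 // => k.
    by rewrite -val_eqE /= eq_sym => /negPf ->.
  by rewrite big1 // => k _; rewrite gtn_eqF // (leq_trans _ gej).
rewrite mulrDl mul1r coefD coefXM !E.
by case: i => [|i].
Qed.

(** Bases modulo [maxJ m]: [1] in degree 0, both pure powers in degrees strictly between 0 and [m],
    the power of ['X_0] in degree [m], nothing above. *)
Lemma maxJ_hilbert : hilbert_series (@maxJ K m)
  (fun i => ((1 + 'X) * (\sum_(k < m) 'X^k) : {poly nat})`_i).
Proof.
move=> i; rewrite coef_hilbert.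
have [->|i0] := posnP i.
  rewrite m0 /=; exists (fun=> 1); split=> [k|a|f hf]; first exact: dhomog1.
    move=> [/(_ 0%N 0 m0) + _] k; rewrite big_ord1 coef_axisZ coef_axis1 mulr1.
    by rewrite (ord1 k).
  exists (fun=> f@_0); rewrite big_ord1.
  split=> [e j lte|]; rewrite !coef_axisB !coef_axisZ !coef_axis1.
    have [->|e0] := eqVneq e 0%N; first by rewrite axis_coef mulm0n mulr1 subrr.
    by rewrite mulr0 subr0 (axis_dhomog _ hf).
  by rewrite !(axis_dhomog _ hf) // -lt0n.
have [P [_ homP axP]] := axis_powers i0.
have [ltim|] := ltnP i m.
  rewrite (ltnW ltim); exists P.
  split=> [k|a|f hf]; first exact: homP.
    move=> [h _] k; have := h i k ltim.
    rewrite big_I2 coef_axisD !coef_axisZ !axP eqxx !andbT.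
    by case: (ord2P k) => ->; rewrite /= ?(mulr0, mulr1, addr0, add0r).
  exists (fun k => (axis k f)`_i); rewrite big_I2.
  split=> [e j lte|]; rewrite !coef_axisB !coef_axisD !coef_axisZ !axP.
    have [->|ei] := eqVneq e i; last by rewrite (axis_dhomog _ hf ei) !andbF !mulr0 addr0 subr0.
    by case: (ord2P j) => ->; rewrite /= ?(mulr0, mulr1, addr0, add0r) subrr.
  by rewrite (gtn_eqF ltim) !andbF !mulr0 !addr0 !subr0 !(axis_dhomog _ hf) // gtn_eqF.
rewrite leq_eqVlt => /orP[/eqP mi|ltmi].
  subst i; rewrite leqnn; exists (fun=> P 0).
  split=> [k|a|f hf]; first exact: homP.
    move=> [_ h] k; move: h; rewrite big_ord1 !coef_axisZ !axP !eqxx /=.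
    by rewrite mulr1 mulr0 (ord1 k).
  (* Modulo [maxJ m] the [m]-th powers of the two variables are opposite, hence the difference. *)
  exists (fun=> (axis 0 f)`_m - (axis 1 f)`_m); rewrite big_ord1.
  split=> [e j lte|]; rewrite !coef_axisB !coef_axisZ !axP.
    rewrite (axis_dhomog _ hf) ?(ltn_eqF lte) //.
    by rewrite andbF mulr0 subr0.
  by rewrite !eqxx /= mulr1 mulr0 subr0 opprB addrC subrK.
rewrite leqNgt ltmi /=; exists (fun=> 0).
split=> [[]//|a _ []//|f hf]; exists (fun=> 0); rewrite big_ord0 subr0.
split=> [e j lte|]; rewrite !(axis_dhomog _ hf) // ltn_eqF //.
exact: ltn_trans ltmi.
Qed.

End Ideal.

Theorem proposition7p1 (m p : nat) (K : fieldType) (xi : K) (c : 'M[K]_2 -> K)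
    (hm : (2 <= m)%N) (hp : p \in [pchar K]) (hpm : ~~ (p %| m)%N) (hp2 : p <> 2%N)
    (hxi : m.-primitive_root xi) (hc : conj_invariant m c)
    (hgen : generic_parameters p m xi c) :
  let x : {mpoly K[2]} := 'X_0 in
  let y : {mpoly K[2]} := 'X_1 in
  exists J : {mpoly K[2]} -> Prop,
    [/\ maximal_graded_submodule hxi hc J,
        (forall J' : {mpoly K[2]} -> Prop,
           maximal_graded_submodule hxi hc J' -> forall f, J' f <-> J f),
        (forall f, J f <-> ideal_gen [:: x * y; x ^+ m + y ^+ m] f)
      & hilbert_series J
          (fun i => ((1 + 'X) * (\sum_(k < m) 'X^k) : {poly nat})`_i)].
Proof.
move=> x y; have m0 : (0 < m)%N by apply: ltnW.
have sub := proper_sub_maxJ hp hpm hp2 hgen.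
exists (maxJ m); split; last exact: maxJ_hilbert.
- by split=> [|N /sub NJ _]; [apply: maxJ_proper|apply: NJ].
(* [J'] is proper, hence inside [maxJ m]; as [maxJ m] is itself proper and graded, maximality of
   [J'] gives the reverse inclusion. *)
- move=> J' [prJ' maxJ'] f; split; first exact: sub prJ' f.
  by apply: maxJ' (maxJ_proper _ _) _ f => q; apply: sub prJ' q.
- by move=> f; apply: maxJ_ideal.
Qed.
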